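(* Let $S$ be an inverse semigroup and let $H$ and $K$ be closed inverse subsemigroups of $S$ with $K\subseteq H$, with $K$ of finite index in $H$ and $H$ of finite index in $S$, and with $K$ full in $S$. Then $K$ has finite index in $S$ and $$[S:K]=[S:H]\,[H:K].$$
   Context: The natural partial order on an inverse semigroup $S$ with idempotent set $E(S)$ is $s\leq t \iff s=et$ for some $e\in E(S)$. A subset $A\subseteq S$ is closed if $a\in A$ and $a\leq s$ imply $s\in A$; the closure of $B\subseteq S$ is $B^{\uparrow}=\{s\in S: s\geq b \text{ for some } b\in B\}$. A subset of $S$ is full if it contains $E(S)$. A closed inverse subsemigroup is a (non-empty) inverse subsemigroup that is a closed subset. For a closed inverse subsemigroup $L$ of $S$, a (right) coset of $L$ in $S$ is a subset of the form $(Ls)^{\uparrow}$ with $s\in S$ and $ss^{-1}\in L$. The index $[S:L]$ is the cardinality of the set of right cosets of $L$ in $S$. *)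

(* Defs.v *)
From HB Require Import structures.
From mathcomp Require Import all_boot finmap.
From mathcomp Require Import boolp classical_sets cardinality.

Set Implicit Arguments.
Unset Strict Implicit.
Unset Printing Implicit Defensive.

Local Open Scope classical_set_scope.
Local Open Scope group_scope.

(* The structure [baseGroupType] carrying the library's inversion operator
   also requires a unit element, hence a separate operator here. *)
HB.mixin Record Semigroup_isInverseSemigroup S of Semigroup S := {
  sinv : S -> S;
  mulsVs : forall x : S, x * sinv x * x = x;
  mulVsV : forall x : S, sinv x * x * sinv x = sinv x;
  sinv_uniq : forall x y : S, x * y * x = x -> y * x * y = y -> y = sinv x
}.

#[short(type="inverseSemigroupType")]
HB.structure Definition InverseSemigroup :=
  { S of Semigroup_isInverseSemigroup S & Semigroup S }.

(* The notions below are relative to an ambient inverse subsemigroup [T] of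
   [S], viewed as an inverse semigroup in its own right; [T := setT] gives the
   notions for [S] itself. *)
Section InverseSemigroupTheory.
Variable S : inverseSemigroupType.
Implicit Types (T A B L : set S) (s t e : S).

Definition idempotents T : set S := [set e | T e /\ e * e = e].

Definition natle T s t : Prop := exists2 e, idempotents T e & s = e * t.

Definition closed_in T A : Prop :=
  forall a s, A a -> T s -> natle T a s -> A s.

Definition upclosure T B : set S :=
  [set s | T s /\ exists2 b, B b & natle T b s].

Definition full_in T A : Prop := idempotents T `<=` A.

Definition inverse_subsemigroup A : Prop :=
  [/\ A !=set0,
      forall x y, A x -> A y -> A (x * y)
    & forall x, A x -> A (sinv x)].

Definition closed_inverse_subsemigroup T L : Prop :=
  [/\ L `<=` T, inverse_subsemigroup L & closed_in T L].

Definition right_coset T L s : set S :=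
  upclosure T [set l * s | l in L].

Definition right_cosets T L : set (set S) :=
  [set right_coset T L s | s in [set s | T s /\ L (s * sinv s)]].

Definition finite_index T L : Prop := finite_set (right_cosets T L).

(* Meaningful when [finite_index T L]; [fset_set] is empty on infinite sets. *)
Definition coset_index T L : nat := #|` fset_set (right_cosets T L)|.

End InverseSemigroupTheory.

(* Main.v *)
Require Import Defs.
From mathcomp Require Import all_boot boolp classical_sets cardinality.
From mathcomp Require Import finmap.

Local Open Scope classical_set_scope.

(** As [K] contains every idempotent, so does [H], and the coset of [s] is the
    class of [s] for the relation [x * s^-1 \in K] (resp. [H]).  Choosing a
    representative [r A] of every coset [A] of [H] in [S], the map sending
    [A] and a coset [B] of [K] in [H] to [{x | x * (r A)^-1 \in B}] is a
    bijection onto the cosets of [K] in [S]. *)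

Lemma cardfsX (T1 T2 : choiceType) (A : {fset T1}) (B : {fset T2}) :
  #|` (A `*` B)%fset| = (#|` A| * #|` B|)%N.
Proof.
rewrite -(size_allpairs pair).
apply: perm_size; apply: uniq_perm => //.
  by apply: allpairs_uniq => // -[a b] [c d].
move=> [a b]; rewrite inE /=; apply/andP/allpairsP => [[aA bB]|].
  by exists (a, b).
by move=> [[c d] /= [cA dB [-> ->]]].
Qed.

(** * Calculus of idempotents and inverses *)

Section InverseSemigroupLemmas.
#[local] Set Implicit Arguments.
#[local] Unset Strict Implicit.
Local Open Scope group_scope.
Variable S : inverseSemigroupType.
Implicit Types (x y e f : S).

Lemma sinvK x : sinv (sinv x) = x.
Proof. by symmetry; apply: sinv_uniq; rewrite ?mulsVs ?mulVsV. Qed.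

Lemma sinv_idem e : e * e = e -> sinv e = e.
Proof. by move=> ee; symmetry; apply: sinv_uniq; rewrite !ee. Qed.

(** By uniqueness of inverses, the inverse [x] of [e * f] equals [f * x * e]. This makes [x]
    idempotent, so it is its own inverse, and [e * f = sinv x = x]. *)
Lemma idem_mul e f : e * e = e -> f * f = f -> (e * f) * (e * f) = e * f.
Proof.
move=> ee ff; pose x := sinv (e * f).
have efxef : e * f * x * (e * f) = e * f by exact: mulsVs.
have xefx : x * (e * f) * x = x by exact: mulVsV.
have xE : f * x * e = x.
  apply: sinv_uniq.
    have -> : e * f * (f * x * e) * (e * f) = e * (f * f) * x * ((e * e) * f).
      by rewrite !mulgA.
    by rewrite ee ff.
  have -> : f * x * e * (e * f) * (f * x * e)
          = f * (x * ((e * e) * (f * f)) * x) * e by rewrite !mulgA.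
  by rewrite ee ff xefx.
have xx : x * x = x.
  rewrite -[in LHS]xE.
  have -> : f * x * e * (f * x * e) = f * (x * (e * f) * x) * e.
    by rewrite !mulgA.
  by rewrite xefx.
have -> : e * f = x by rewrite -(sinvK (e * f)) -/x sinv_idem.
exact: xx.
Qed.

(** Both [e * f] and [f * e] are inverses of [e * f]. *)
Lemma idem_comm e f : e * e = e -> f * f = f -> e * f = f * e.
Proof.
move=> ee ff; have efi := idem_mul ee ff; have fei := idem_mul ff ee.
rewrite -(sinv_idem efi); symmetry; apply: sinv_uniq.
  have -> : e * f * (f * e) * (e * f) = e * (f * f) * (e * e) * f.
    by rewrite !mulgA.
  by rewrite ee ff -[RHS]efi !mulgA.
have -> : f * e * (e * f) * (f * e) = f * (e * e) * (f * f) * e.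
  by rewrite !mulgA.
by rewrite ee ff -[RHS]fei !mulgA.
Qed.

Lemma mulsV_idem x : (x * sinv x) * (x * sinv x) = x * sinv x.
Proof. by rewrite mulgA mulsVs. Qed.

Lemma mulVs_idem x : (sinv x * x) * (sinv x * x) = sinv x * x.
Proof. by rewrite mulgA mulVsV. Qed.

Lemma sinvM x y : sinv (x * y) = sinv y * sinv x.
Proof.
have yx := idem_comm (mulsV_idem y) (mulVs_idem x).
symmetry; apply: sinv_uniq.
  have -> : x * y * (sinv y * sinv x) * (x * y)
          = x * ((y * sinv y) * (sinv x * x)) * y by rewrite !mulgA.
  by rewrite yx !mulgA mulsVs -!mulgA (mulgA y) mulsVs.
have -> : sinv y * sinv x * (x * y) * (sinv y * sinv x)
        = sinv y * ((sinv x * x) * (y * sinv y)) * sinv x by rewrite !mulgA.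
by rewrite -yx !mulgA mulVsV -!mulgA (mulgA (sinv x)) mulVsV.
Qed.

(** Conjugation carries an idempotent from the right of [x] to its left, where [natle] expects
    it. *)
Lemma mul_idem_conj x e : e * e = e -> x * e = (x * e * sinv x) * x.
Proof.
move=> ee.
have -> : x * e * sinv x * x = x * (e * (sinv x * x)) by rewrite !mulgA.
by rewrite (idem_comm ee (mulVs_idem x)) !mulgA mulsVs.
Qed.

Lemma conj_idem x e :
  e * e = e -> (x * e * sinv x) * (x * e * sinv x) = x * e * sinv x.
Proof.
move=> ee; rewrite [LHS]mulgA [X in X * _](mulgA _ x e).
by rewrite -(mul_idem_conj x ee) -(mulgA x) ee.
Qed.

End InverseSemigroupLemmas.

(** * Cosets of a full closed inverse subsemigroup as equivalence classes *)

Section FullClosedSubsemigroup.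
#[local] Set Implicit Arguments.
#[local] Unset Strict Implicit.
Local Open Scope group_scope.
Variables (S : inverseSemigroupType) (L : set S).
Hypothesis Lclosed : closed_inverse_subsemigroup setT L.
Hypothesis Lfull : full_in setT L.
Implicit Types (x y s t e : S).

Lemma full_idem e : e * e = e -> L e.
Proof. by move=> ee; apply: Lfull. Qed.

Lemma full_mul x y : L x -> L y -> L (x * y).
Proof. by case: Lclosed => _ [_ + _] _; apply. Qed.

Lemma full_inv x : L x -> L (sinv x).
Proof. by case: Lclosed => _ [_ _ +] _; apply. Qed.

(** [x * e * y] lies below [x * y] in the natural order, and [L] is closed upwards. *)
Lemma full_del x e y : e * e = e -> L (x * e * y) -> L (x * y).
Proof.
move=> ee Lxey; case: Lclosed => _ _ /(_ _ (x * y) Lxey I); apply.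
by exists (x * e * sinv x);
  [split=> //; exact: conj_idem | rewrite mulgA -mul_idem_conj].
Qed.

Lemma full_divr x y : L y -> L (x * sinv y) -> L x.
Proof.
(* Writing [x] as [x * (sinv x * x)] makes room for the idempotent [sinv y * y] in the middle, which
   [full_del] then removes. *)
move=> Ly Lxy; rewrite -(mulsVs x) -mulgA.
apply: (full_del (mulVs_idem y)).
apply: full_mul; last exact/full_idem/mulVs_idem.
by rewrite mulgA; exact: full_mul.
Qed.

Lemma full_trans x s t : L (x * sinv s) -> L (s * sinv t) -> L (x * sinv t).
Proof.
move=> xs st; apply: (full_del (mulVs_idem s)).
by rewrite !mulgA -(mulgA (x * sinv s)); exact: full_mul.
Qed.

Lemma full_sym x s : L (x * sinv s) -> L (s * sinv x).
Proof. by move=> /full_inv; rewrite sinvM sinvK. Qed.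

Lemma full_refl x : L (x * sinv x).
Proof. exact/full_idem/mulsV_idem. Qed.

Lemma right_cosetE (T : set S) s :
    (forall x y, T x -> T y -> T (x * y)) -> (forall x, T x -> T (sinv x)) ->
    T s ->
  right_coset T L s = [set x | T x /\ L (x * sinv s)].
Proof.
move=> TM TV Ts; apply/seteqP; split=> x [Tx].
  move=> [_ [l Ll <-] [e [_ ee] lsE]]; split=> //.
  (* From [l * s] below [x] follows [l * s * sinv s] below [x * sinv s], and the former is in
     [L]. *)
  case: Lclosed => _ _ Lup; apply: (Lup (l * s * sinv s)) => //.
    by rewrite -mulgA; apply: full_mul => //; exact: full_refl.
  by exists e => //; rewrite lsE mulgA.
move=> Lxs; split=> //; exists (x * sinv s * s); first by exists (x * sinv s).
(* The conjugate of [sinv s * s] by [x] shows that [x * sinv s * s] lies below [x]; it is in [T]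
   because [T] is stable under products and inverses. *)
exists (x * (sinv s * s) * sinv x); last first.
  by rewrite -(mul_idem_conj x (mulVs_idem s)) mulgA.
split; last by apply: conj_idem; exact: mulVs_idem.
by apply: (TM); [do 2!apply: (TM) => //; exact: TV | exact: TV].
Qed.

Lemma mem_right_cosets (T : set S) (A : set S) :
    (forall x y, T x -> T y -> T (x * y)) -> (forall x, T x -> T (sinv x)) ->
  right_cosets T L A <->
    exists2 s, T s & A = [set x | T x /\ L (x * sinv s)].
Proof.
move=> TM TV; split=> [[s [Ts _] <-]|[s Ts ->]].
  by exists s => //; exact: right_cosetE.
by exists s; [split=> //; exact: full_refl | exact: right_cosetE].
Qed.

End FullClosedSubsemigroup.

(** * The bijection between pairs of cosets and cosets of [K] *)

Section Tower.
#[local] Set Implicit Arguments.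
#[local] Unset Strict Implicit.
Local Open Scope group_scope.
Variables (S : inverseSemigroupType) (H K : set S).
Hypothesis Hclosed : closed_inverse_subsemigroup setT H.
Hypothesis Kclosed : closed_inverse_subsemigroup setT K.
Hypothesis sKH : K `<=` H.
Hypothesis Kfull : full_in setT K.

Let Hfull : full_in setT H. Proof. exact: subset_trans sKH. Qed.

Let cosetsHE (A : set S) : right_cosets setT H A <->
  exists s, A = [set x | H (x * sinv s)].
Proof.
rewrite mem_right_cosets //; split=> [[s _ ->]|[s ->]]; exists s => //.
  by apply/seteqP; split=> x; [case|].
by apply/seteqP; split=> x; [|case].
Qed.

Let cosetsKE (A : set S) : right_cosets setT K A <->
  exists s, A = [set x | K (x * sinv s)].
Proof.
rewrite mem_right_cosets //; split=> [[s _ ->]|[s ->]]; exists s => //.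
  by apply/seteqP; split=> x; [case|].
by apply/seteqP; split=> x; [|case].
Qed.

Let cosetsKHE (B : set S) : right_cosets H K B <->
  exists2 h, H h & B = [set x | H x /\ K (x * sinv h)].
Proof.
by apply: mem_right_cosets => // [x y|x]; [exact: full_mul | exact: full_inv].
Qed.

(* [s0] is only a default value, returned when [A] is empty. *)
Definition glue_cosets (s0 : S) (AB : set S * set S) : set S :=
  [set x | AB.2 (x * sinv (xget s0 AB.1))].

Lemma coset_repr (s0 : S) (A : set S) : right_cosets setT H A ->
  A = [set x | H (x * sinv (xget s0 A))].
Proof.
move=> /cosetsHE[s AE].
have : A (xget s0 A).
  by apply: xgetPex; exists s; rewrite AE; exact: full_refl.
set r := xget s0 A; rewrite {1}AE /= => rs.
rewrite AE; apply/seteqP; split=> x /= xs; apply: full_trans xs _ => //.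
exact: full_sym.
Qed.

(** The condition [H (x * sinv r)], with [r] the representative of [A], comes for free: [K] is
    inside [H], and [h] in [H] can be cancelled. *)
Lemma glue_cosetsE (s0 : S) (A : set S) (h : S) : H h ->
  glue_cosets s0 (A, [set x | H x /\ K (x * sinv h)]) =
  [set x | K (x * sinv (h * xget s0 A))].
Proof.
rewrite /glue_cosets /= => Hh.
apply/seteqP; split=> x /=; rewrite sinvM mulgA; first by case.
by move=> Kx; split=> //; apply: (full_divr _ Hfull Hh) => //; exact: sKH.
Qed.

Lemma glue_cosets_image (s0 : S) :
  glue_cosets s0 @` (right_cosets setT H `*` right_cosets H K)
  = right_cosets setT K.
Proof.
apply/seteqP; split=> [_ [[A B] /= [_ /cosetsKHE[h Hh ->]] <-]|C].
  by rewrite glue_cosetsE //; apply/cosetsKE; exists (h * xget s0 A).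
move=> /cosetsKE[s ->].
pose A := [set x | H (x * sinv s)].
have HA : right_cosets setT H A by apply/cosetsHE; exists s.
have Hsr : H (s * sinv (xget s0 A)).
  have : A s by exact: full_refl.
  by rewrite {1}(coset_repr s0 HA).
(* With [r] the representative of [A], the choice [h := s * sinv r] is in [H], and [h * r] is
   equivalent to [s] modulo [K]. *)
exists (A, [set x | H x /\ K (x * sinv (s * sinv (xget s0 A)))]) => /=.
  by split=> //; apply/cosetsKHE; exists (s * sinv (xget s0 A)).
rewrite glue_cosetsE //; set r := xget s0 A.
have Ksr : K (s * sinv r * r * sinv s).
  apply: full_idem => //; rewrite -(mulgA s).
  by apply: conj_idem; exact: mulVs_idem.
apply/seteqP; split=> x /= Kx; apply: full_trans Kx _ => //.
by apply: full_sym.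
Qed.

Lemma glue_cosets_inj (s0 : S) :
  {in right_cosets setT H `*` right_cosets H K &, injective (glue_cosets s0)}.
Proof.
move=> [A B] [A' B'] /set_mem[/= HA KB] /set_mem[/= HA' KB'].
case/cosetsKHE: KB => h Hh ->; case/cosetsKHE: KB' => h' Hh' ->.
rewrite !glue_cosetsE // => glueE.
(* The element [h * xget s0 A] belongs to its own coset, hence to the other one. *)
have Khr : K (h * xget s0 A * sinv (h' * xget s0 A')).
  have : [set x | K (x * sinv (h * xget s0 A))] (h * xget s0 A).
    exact: full_refl.
  by rewrite glueE.
(* Modulo [H] the factors [h] and [h'] cancel, so the two representatives are equivalent and
   [A = A']. *)
have Hrr : H (xget s0 A * sinv (xget s0 A')).
  apply: (full_divr _ Hfull Hh') => //; rewrite -mulgA -sinvM.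
  apply: full_sym => //; apply: (full_divr _ Hfull Hh) => //.
  rewrite -mulgA -sinvM; apply: full_sym => //; exact: sKH.
have AA' : A = A'.
  rewrite (coset_repr s0 HA) (coset_repr s0 HA').
  apply/seteqP; split=> x /= Hx; apply: full_trans Hx _ => //.
  exact: full_sym.
(* The representatives now agree, leaving an idempotent between [h] and [sinv h'] to delete. *)
have Khh : K (h * sinv h').
  apply: (full_del _ (mulsV_idem (xget s0 A))) => //.
  by move: Khr; rewrite -AA' sinvM !mulgA.
rewrite AA'; congr pair.
apply/seteqP; split=> x /= [Hx Kx]; split=> //; apply: full_trans Kx _ => //.
exact: full_sym.
Qed.

End Tower.

Theorem theorem2p8 (S : inverseSemigroupType) (H K : set S) :
  closed_inverse_subsemigroup setT H ->
  closed_inverse_subsemigroup setT K ->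
  K `<=` H ->
  finite_index H K ->
  finite_index setT H ->
  full_in setT K ->
  finite_index setT K /\ 
    coset_index setT K = (coset_index setT H * coset_index H K)%N.
Proof.
move=> Hclosed Kclosed sKH finHK finSH Kfull.
(* Non-emptiness of [H] supplies the default value [s0]. *)
have [_ [[s0 _] _ _] _] := Hclosed.
have finX := finite_setX finSH finHK.
have imK := glue_cosets_image Hclosed Kclosed sKH Kfull s0.
split; first by rewrite /finite_index -imK; exact: finite_image.
rewrite /coset_index -imK fset_set_image // card_in_imfset /=.
  by rewrite fset_setX // cardfsX.
move=> AB AB'; rewrite !in_fset_set //.
exact: (glue_cosets_inj Hclosed Kclosed sKH Kfull).
Qed.
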